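(* There exists a potential $V:\mathbb{Z}^+\to\mathbb{R}$ such that the half-line operator $h_V^+$ has $0$ as an eigenvalue, has infinitely many eigenvalues outside $[-2,2]$, and these eigenvalues $\{E_n\}_{n\ge1}$, ordered so that $|E_1|\ge|E_2|\ge\cdots$, satisfy $$C_1\, b^n \le |E_n|-2 \le C_2\, c^n \quad\text{for all } n\ge1$$ for suitable constants $0<b\le c<1$ and $C_1,C_2>0$.
   Context: $\mathbb{Z}^+=\{0,1,2,\dots\}$. For $V:\mathbb{Z}^+\to\mathbb{R}$, the half-line discrete Schrödinger operator $h_V^+$ acts on $\ell^2(\mathbb{Z}^+)$ by $[h_V^+\phi](n)=\phi(n+1)+\phi(n-1)+V(n)\phi(n)$ with the convention $\phi(-1)=0$. Eigenvalues of $h_V^+$ lying outside $[-2,2]$ are called bound states. *)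

(* Defs.v *)
From Stdlib Require Import Reals.
From Coquelicot Require Import Coquelicot.
Open Scope R_scope.

(* Half-line discrete Schroedinger operator on Z^+ = {0,1,2,...},
   [h_V^+ phi](n) = phi(n+1) + phi(n-1) + V(n) phi(n), with phi(-1) = 0. *)
Definition hplus (V : nat -> R) (phi : nat -> R) (n : nat) : R :=
  phi (S n) + (match n with O => 0 | S m => phi m end) + V n * phi n.

Definition in_l2 (phi : nat -> R) : Prop := ex_series (fun n => (phi n) ^ 2).

Definition is_eigenvalue (V : nat -> R) (E : R) : Prop :=
  exists phi : nat -> R,
    in_l2 phi /\ (exists n, phi n <> 0) /\ (forall n, hplus V phi n = E * phi n).

Definition bound_state (V : nat -> R) (E : R) : Prop :=
  is_eigenvalue V E /\ (E < -2 \/ 2 < E).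

(* Main.v *)
Require Import Defs.
From Stdlib Require Import Reals Lra Lia Classical ClassicalEpsilon.
From Coquelicot Require Import Coquelicot.
Open Scope R_scope.

(* The potential is V(0) = -1, V(2m) = 32/m, V(2m-1) = -32/(m+32). With q_m = m/(m+32) and f_m = q_1
   ... q_m it equals f_(m-1)/f_m - 1 at 2m and f_m/f_(m-1) - 1 at 2m-1, so that phi(2m) = phi(2m+1)
   = (-1)^m f_m is an l2 solution at energy 0, while g(2m) = f_m = -g(2m+1) is one at energy -2. As
   g changes sign at every site, its Wronskian with a solution at energy E < -2 cannot tend to 0,
   hence there is no bound state below -2.

   For E > 2 let u_E solve the equation from the left. Following the ratio u(n+1)/u(n) together with
   the number of nodes (sign changes) gives a discrete Pruefer angle, which is monotone in the
   energy and under comparison. There is exactly one eigenvalue above 2 with j nodes: it is the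
   supremum of the energies with more than j nodes, and two of them would have ratios drifting
   apart. So the j-th bound state is the one with j nodes. Near energy 2 the two-site averaged
   equation is an inverse-square attraction of overcritical strength: for L = 2^j large there are at
   most 256 nodes between 2L and 4L, and at least one as long as L^2 (E - 2) <= 1. Hence the number
   of nodes at energy 2 + eps is comparable to log(1/eps), which is the exponential bound. *)

(** * Solutions of the eigenvalue equation from the left boundary *)

Fixpoint sol_pair (V : nat -> R) (E : R) (n : nat) : R * R :=
  match n with
  | O => (1, E - V O)
  | S m => let (x, y) := sol_pair V E m in (y, (E - V (S m)) * y - x)
  end.

Definition sol (V : nat -> R) (E : R) (n : nat) : R := fst (sol_pair V E n).

Lemma sol_0 V E : sol V E 0 = 1.
Proof. reflexivity. Qed.

Lemma sol_1 V E : sol V E 1 = E - V O.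
Proof. reflexivity. Qed.

Lemma sol_SS V E n :
  sol V E (S (S n)) = (E - V (S n)) * sol V E (S n) - sol V E n.
Proof.
  unfold sol; simpl; destruct (sol_pair V E n) as [x y]; reflexivity.
Qed.

Lemma hplus_sol V E n : hplus V (sol V E) n = E * sol V E n.
Proof.
  destruct n as [|n]; unfold hplus.
  - rewrite sol_1, sol_0; ring.
  - rewrite sol_SS; ring.
Qed.

Lemma hplus_unique V E phi :
  (forall n, hplus V phi n = E * phi n) -> forall n, phi n = phi O * sol V E n.
Proof.
  intros H n.
  enough (phi n = phi O * sol V E n /\ phi (S n) = phi O * sol V E (S n)) by tauto.
  induction n as [|n [IH1 IH2]].
  - rewrite sol_0, sol_1. specialize (H O). unfold hplus in H. split; lra.
  - split; [exact IH2|]. specialize (H (S n)). unfold hplus in H.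
    rewrite sol_SS. rewrite IH1, IH2 in *. lra.
Qed.

(** The boundary condition leaves a one-dimensional solution space, so only the solution with value
    1 at site 0 has to be tested. *)
Lemma eigenvalue_sol_l2 V E : is_eigenvalue V E <-> in_l2 (sol V E).
Proof.
  split.
  - intros (phi & Hl & (n & Hn) & H).
    pose proof (hplus_unique V E phi H) as Hu.
    assert (H0 : phi O <> 0) by (intro H0; apply Hn; rewrite Hu, H0; ring).
    unfold in_l2 in *.
    apply ex_series_ext with (fun n => / (phi O) ^ 2 * phi n ^ 2).
    + intro k. rewrite (Hu k). simpl. field; auto.
    + exact (ex_series_scal_l (/ (phi O) ^ 2) _ Hl).
  - intro Hl. exists (sol V E). repeat split; auto.
    + exists O. rewrite sol_0; lra.
    + apply hplus_sol.
Qed.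

Lemma l2_lim_0 phi : in_l2 phi -> is_lim_seq phi 0.
Proof.
  intro H. apply ex_series_lim_0 in H.
  apply is_lim_seq_spec. apply is_lim_seq_spec in H.
  intro eps. destruct (H (mkposreal (eps * eps) (Rmult_lt_0_compat _ _ (cond_pos eps) (cond_pos eps)))) as [N HN].
  exists N; intros n Hn. specialize (HN n Hn). simpl in HN.
  rewrite Rminus_0_r in *. rewrite Rmult_1_r in HN.
  rewrite Rabs_mult in HN.
  destruct (Rlt_or_le (Rabs (phi n)) eps) as [h|h]; auto.
  pose proof (cond_pos eps). nra.
Qed.

Lemma continuous_sol V n E : continuous (fun x => sol V x n) E.
Proof.
  enough (continuous (fun x => sol V x n) E /\ continuous (fun x => sol V x (S n)) E) by tauto.
  induction n as [|n [IH1 IH2]].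
  - split.
    + apply continuous_const.
    + apply (continuous_ext (fun x => x - V O)); [reflexivity|].
      apply (continuous_minus (fun x => x) (fun _ => V O)); [apply continuous_id|apply continuous_const].
  - split; [exact IH2|].
    apply (continuous_ext (fun x => (x - V (S n)) * sol V x (S n) - sol V x n)).
    + intro x. now rewrite sol_SS.
    + apply (continuous_minus (fun x => (x - V (S n)) * sol V x (S n)) (fun x => sol V x n)); auto.
      apply (continuous_mult (fun x => x - V (S n)) (fun x => sol V x (S n))); auto.
      apply (continuous_minus (fun x => x) (fun _ => V (S n))); [apply continuous_id|apply continuous_const].
Qed.

Lemma locally_pos (f : R -> R) x :
  continuous f x -> 0 < f x -> locally x (fun y => 0 < f y).
Proof. intros Hc Hp. apply (Hc (fun y => 0 < y)). now apply open_gt. Qed.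

(** * Discrete Pruefer angle *)

(* A state [(c, o)] is a discretised Pruefer angle: [c] counts the sign changes met so far and [o]
   is the current ratio [u (n+1) / u n], with [None] for the ratio [-infinity] at a zero [u n = 0].
   *)
Definition state : Type := (nat * option R)%type.

(** The Riccati recursion r -> a - 1 / r for ratios of consecutive values. A zero of the solution is
    counted as a node only on leaving it: ratio 0 leads to [None] with the same count, and [None]
    adds the node. *)
Definition step (a : R) (s : state) : state :=
  match s with
  | (c, None) => (S c, Some a)
  | (c, Some r) =>
      if Rlt_dec r 0 then (S c, Some (a - / r))
      else if Req_dec_T r 0 then (c, None) else (c, Some (a - / r))
  end.

Fixpoint angle (V : nat -> R) (E : R) (n : nat) : state :=
  match n with
  | O => (O, Some (E - V O))
  | S m => step (E - V (S m)) (angle V E m)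
  end.

Definition nodes V E n : nat := fst (angle V E n).

(** A larger angle means more nodes; within one count the angle grows as the ratio falls from
    +infinity to -infinity, so ratios are compared in reverse. *)
Definition angle_le (s s' : state) : Prop :=
  (fst s < fst s')%nat \/
  fst s = fst s' /\
  match snd s, snd s' with
  | _, None => True
  | None, Some _ => False
  | Some r, Some r' => r' <= r
  end.

Lemma angle_le_fst s s' : angle_le s s' -> (fst s <= fst s')%nat.
Proof. intros [H|[H _]]; lia. Qed.

Lemma step_fst a s : fst (step a s) = fst s \/ fst (step a s) = S (fst s).
Proof.
  destruct s as [c [r|]]; simpl; auto.
  destruct (Rlt_dec r 0); [|destruct (Req_dec_T r 0)]; simpl; auto.
Qed.

Lemma angle_le_trans s1 s2 s3 : angle_le s1 s2 -> angle_le s2 s3 -> angle_le s1 s3.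
Proof.
  destruct s1 as [c1 [r1|]], s2 as [c2 [r2|]], s3 as [c3 [r3|]]; unfold angle_le; simpl;
    intros [H|[H Hr]] [K|[K Ks]]; try contradiction; try (left; lia);
    right; split; try lia; auto; lra.
Qed.

(** A step adds at most one node, and right after a node the ratio is at least [a], because - 1 / r
    is then positive or absent. Nothing about the ratio in [s] is used. *)
Lemma step_upper_S a s c t :
  (fst s <= c)%nat -> t <= a -> angle_le (step a s) (S c, Some t).
Proof.
  destruct s as [c' [r|]]; unfold angle_le; simpl; intros Hc Ht.
  - destruct (Rlt_dec r 0) as [h|h]; [|destruct (Req_dec_T r 0)]; simpl; try (left; lia).
    destruct (Nat.eq_dec c' c) as [->|]; [right|left; lia].
    split; auto. assert (/ r < 0) by now apply Rinv_lt_0_compat. lra.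
  - destruct (Nat.eq_dec c' c) as [->|]; [right; auto|left; lia].
Qed.

(** Dual to [step_upper_S]: a step that adds no node starts from r >= 0, so it ends with ratio below
    [a] or at a zero. *)
Lemma step_lower_fst a s t : a <= t -> angle_le (fst s, Some t) (step a s).
Proof.
  intros H. destruct s as [c [r|]]; unfold angle_le; simpl.
  - destruct (Rlt_dec r 0); [|destruct (Req_dec_T r 0)]; simpl; auto.
    right; split; auto. assert (0 < / r) by (apply Rinv_0_lt_compat; lra). lra.
  - auto.
Qed.

(** Sturm comparison for one site: r -> a - 1 / r increases on each side of 0, and the jump at 0 is
    exactly what the node count records. *)
Lemma step_mono a a' s s' :
  angle_le s s' -> a' <= a -> angle_le (step a s) (step a' s').
Proof.
  intros [H|[H Hr]] Ha.
  (* When the counts differ, this state separates the two images. *)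
  - apply angle_le_trans with (fst s', Some a').
    + destruct s' as [[|c'] o']; simpl in *; [lia|]. apply step_upper_S; [lia|auto].
    + now apply step_lower_fst, Rle_refl.
  - destruct s as [c o], s' as [c' o']; simpl in H, Hr; subst c'; unfold angle_le.
    assert (Hneg : forall r, r < 0 -> / r < 0) by (intros; now apply Rinv_lt_0_compat).
    assert (Hanti : forall r r', 0 < r' -> r' <= r -> / r <= / r') by (intros; now apply Rinv_le_contravar).
    destruct o as [r|], o' as [r'|]; simpl; try contradiction.
    + destruct (Rlt_dec r' 0) as [h'|h'], (Rlt_dec r 0) as [h|h]; simpl.
      * right; split; auto.
        pose proof (Hanti (- r') (- r) ltac:(lra) ltac:(lra)) as K. rewrite !Rinv_opp in K. lra.
      * destruct (Req_dec_T r 0); left; simpl; lia.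
      * lra.
      * destruct (Req_dec_T r' 0) as [g'|g'], (Req_dec_T r 0) as [g|g]; simpl; auto; try lra.
        right; split; auto. pose proof (Hanti r r' ltac:(lra) Hr). lra.
    + destruct (Rlt_dec r 0) as [h|h]; [|destruct (Req_dec_T r 0)]; simpl; auto.
      right; split; auto. pose proof (Hneg r h). lra.
    + right; split; auto.
Qed.

Lemma angle_mono V x y n : x <= y -> angle_le (angle V y n) (angle V x n).
Proof.
  intro H. induction n as [|n IH]; simpl.
  - right; simpl; split; auto; lra.
  - apply step_mono; auto; lra.
Qed.

Lemma nodes_le V E m n : (m <= n)%nat -> (nodes V E m <= nodes V E n)%nat.
Proof.
  induction 1 as [|n H IH]; auto.
  unfold nodes in *; simpl. destruct (step_fst (E - V (S n)) (angle V E n)); lia.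
Qed.

Lemma nodes_le_index V E n : (nodes V E n <= n)%nat.
Proof.
  induction n as [|n IH]; auto.
  unfold nodes in *; simpl. destruct (step_fst (E - V (S n)) (angle V E n)); lia.
Qed.

Lemma nodes_mono V x y n : x <= y -> (nodes V y n <= nodes V x n)%nat.
Proof. intro H. now apply angle_le_fst, angle_mono. Qed.

Lemma pow_m1_S c x : (-1) ^ S c * x = - ((-1) ^ c * x).
Proof. simpl; ring. Qed.

(** The invariant tying states to the solution: the parity of the count is the sign of the current
    value, or, at a zero, the opposite of the sign of the next value. *)
Lemma angle_sol V E n :
  match angle V E n with
  | (c, Some r) => 0 < (-1) ^ c * sol V E n /\ sol V E (S n) = r * sol V E n
  | (c, None) => sol V E n = 0 /\ 0 < (-1) ^ S c * sol V E (S n)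
  end.
Proof.
  induction n as [|n IH]; [simpl angle; rewrite sol_0, sol_1; simpl; lra|].
  simpl angle. destruct (angle V E n) as [c [r|]]; simpl step.
  - destruct IH as [H1 H2].
    destruct (Rlt_dec r 0); [|destruct (Req_dec_T r 0)]; rewrite ?pow_m1_S, ?sol_SS, ?H2.
    + split; [|field; lra].
      replace (- ((-1) ^ c * (r * sol V E n))) with (- r * ((-1) ^ c * sol V E n)) by ring.
      apply Rmult_lt_0_compat; lra.
    + subst r. split; [ring|].
      now replace (- _) with ((-1) ^ c * sol V E n) by ring.
    + split; [|field; assumption].
      replace ((-1) ^ c * (r * sol V E n)) with (r * ((-1) ^ c * sol V E n)) by ring.
      apply Rmult_lt_0_compat; lra.
  - destruct IH as [H1 H2]. split; [exact H2|]. rewrite sol_SS, H1; ring.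
Qed.

Lemma pow_m1_cases c : (-1) ^ c = 1 \/ (-1) ^ c = -1.
Proof. induction c; simpl; lra. Qed.

Lemma angle_Some_locally V E n c r :
  angle V E n = (c, Some r) ->
  locally E (fun x => 0 < (-1) ^ c * sol V x n).
Proof.
  intro H. pose proof (angle_sol V E n) as HI. rewrite H in HI.
  apply (locally_pos (fun x => (-1) ^ c * sol V x n)); [|tauto].
  apply (continuous_mult (fun _ => (-1) ^ c) (fun x => sol V x n));
    [apply continuous_const|apply continuous_sol].
Qed.

Lemma nodes_parity V x n c :
  0 < (-1) ^ c * sol V x n ->
  (exists r, angle V x n = (nodes V x n, Some r)) /\ (-1) ^ nodes V x n = (-1) ^ c.
Proof.
  intro H. pose proof (angle_sol V x n) as HI. unfold nodes.
  destruct (angle V x n) as [c' [r|]]; simpl in *.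
  - split; [now exists r|]. destruct HI as [HI _].
    destruct (pow_m1_cases c) as [e|e], (pow_m1_cases c') as [e'|e']; rewrite e, e' in *; lra.
  - destruct HI as [HI _]. rewrite HI in H. lra.
Qed.

Lemma nodes_locally V E n :
  locally E (fun x =>
    match snd (angle V E n) with
    | Some _ => nodes V x n = nodes V E n
    | None => (nodes V E n <= nodes V x n <= S (nodes V E n))%nat
    end).
Proof.
  (* At a nonzero value [u (S n)] the parity of the node count is the sign of [u (S n)], which is
     locally constant; this decides between the two values left by the previous site. *)
  induction n as [|n IH].
  - apply filter_forall. reflexivity.
  - assert (Hstep : forall x, nodes V x (S n) = nodes V x n \/ nodes V x (S n) = S (nodes V x n))
      by (intro x; apply step_fst).
    destruct (angle V E (S n)) as [c' o'] eqn:HA.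
    assert (Hpar : match o' with Some _ => locally E (fun x => (-1) ^ nodes V x (S n) = (-1) ^ c') | None => True end).
    { destruct o' as [r'|]; auto.
      apply (filter_imp (fun x => 0 < (-1) ^ c' * sol V x (S n))); [|eapply angle_Some_locally; eassumption].
      intros x Hx. now apply nodes_parity. }
    assert (Hc' : nodes V E (S n) = c') by (unfold nodes; now rewrite HA).
    simpl in HA. unfold nodes in IH at 2 3 6. rewrite Hc'.
    destruct (angle V E n) as [c [r|]]; simpl in *.
    + assert (Hgen : locally E (fun x => nodes V x (S n) = c \/ nodes V x (S n) = S c)).
      { revert IH; apply filter_imp. intros x Hx. specialize (Hstep x). rewrite Hx in Hstep. exact Hstep. }
      destruct (Rlt_dec r 0); [|destruct (Req_dec_T r 0)]; injection HA as <- <-; simpl.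
      * generalize (filter_and _ _ Hgen Hpar); apply filter_imp.
        intros x [[e|e] Hp]; auto. rewrite e in Hp. destruct (pow_m1_cases c); simpl in Hp; lra.
      * revert Hgen; apply filter_imp. intros x Hx; lia.
      * generalize (filter_and _ _ Hgen Hpar); apply filter_imp.
        intros x [[e|e] Hp]; auto. rewrite e in Hp. destruct (pow_m1_cases c); simpl in Hp; lra.
    + injection HA as <- <-; simpl.
      generalize (filter_and _ _ IH Hpar); apply filter_imp.
      intros x [Hx Hp].
      assert (H : nodes V x (S n) = c \/ nodes V x (S n) = S c \/ nodes V x (S n) = S (S c))
        by (destruct (Hstep x); lia).
      destruct H as [e|[e|e]]; auto; rewrite e in Hp; destruct (pow_m1_cases c); simpl in Hp; lra.
Qed.

(** Barrier form of [step_mono]: with coefficient t' + 1 / t the comparison state moves from ratio t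
    exactly to t'. Inductions along explicit barriers use this and [step_lower]. *)
Lemma step_upper a s c t t' :
  angle_le s (c, Some t) -> 0 < t -> t' <= a - / t -> angle_le (step a s) (c, Some t').
Proof.
  intros H Ht Ht'.
  pose proof (step_mono a (t' + / t) _ _ H ltac:(lra)) as K. simpl in K.
  destruct (Rlt_dec t 0); [lra|]. destruct (Req_dec_T t 0); [lra|].
  now replace (t' + / t - / t) with t' in K by ring.
Qed.

Lemma step_lower a s c t t' :
  angle_le (c, Some t) s -> 0 < t -> a - / t <= t' -> angle_le (c, Some t') (step a s).
Proof.
  intros H Ht Ht'.
  pose proof (step_mono (t' + / t) a _ _ H ltac:(lra)) as K. simpl in K.
  destruct (Rlt_dec t 0); [lra|]. destruct (Req_dec_T t 0); [lra|].
  now replace (t' + / t - / t) with t' in K by ring.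
Qed.

Lemma step_node a s c t : angle_le (c, Some t) s -> t < 0 -> (S c <= fst (step a s))%nat.
Proof.
  intros H Ht. pose proof (step_mono a a _ _ H ltac:(lra)) as K. simpl in K.
  destruct (Rlt_dec t 0); [|lra]. apply angle_le_fst in K. exact K.
Qed.

(** * Eigenvalues above 2 are labelled by their number of nodes *)

Definition limsup_nonpos (V : nat -> R) : Prop :=
  forall eps, 0 < eps -> exists n0, forall n, (n0 <= n)%nat -> V n <= eps.

(** Where the coefficient is at least 2, ratio 1 is a barrier, since 2 - 1 / 1 = 1. Only the first
    step past [n] can cost a node before the barrier applies. *)
Lemma nodes_after V E n :
  (forall k, (n < k)%nat -> 2 <= E - V k) ->
  forall m, (nodes V E m <= S (nodes V E n))%nat.
Proof.
  intros Ha m.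
  destruct (Nat.le_gt_cases m n) as [Hm|Hm].
  - pose proof (nodes_le V E m n Hm); lia.
  - apply (angle_le_fst _ (S (nodes V E n), Some 1)).
    induction m as [|m IH]; [lia|]. simpl.
    pose proof (Ha (S m) Hm).
    destruct (Nat.eq_dec n m) as [->|Hne].
    + apply step_upper_S; [unfold nodes; lia|lra].
    + apply step_upper with 1; [apply IH; lia|lra|rewrite Rinv_1; lra].
Qed.

Lemma ratio_ge_1_after V E n c r :
  (forall k, (n < k)%nat -> 2 <= E - V k) ->
  angle V E n = (c, Some r) -> 1 <= r ->
  forall m, (n <= m)%nat -> exists r', angle V E m = (c, Some r') /\ 1 <= r'.
Proof.
  intros Ha H Hr m Hm. induction Hm as [|m Hm (r' & IH & Hr')]; [now exists r|].
  exists (E - V (S m) - / r'). simpl. rewrite IH. simpl.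
  destruct (Rlt_dec r' 0); [lra|]. destruct (Req_dec_T r' 0); [lra|].
  split; auto. specialize (Ha (S m) ltac:(lia)).
  assert (/ r' <= / 1) by (apply Rinv_le_contravar; lra). rewrite Rinv_1 in *; lra.
Qed.

Lemma ratio_ge_1_not_decaying V E n c r :
  (forall k, (n < k)%nat -> 2 <= E - V k) ->
  angle V E n = (c, Some r) -> 1 <= r -> ~ is_lim_seq (sol V E) 0.
Proof.
  intros Ha H Hr Hlim.
  assert (Hn : 0 < Rabs (sol V E n)).
  { pose proof (angle_sol V E n) as K. rewrite H in K. destruct K as [K _].
    apply Rabs_pos_lt. intro e. rewrite e in K. lra. }
  assert (Hg : forall m, (n <= m)%nat -> Rabs (sol V E n) <= Rabs (sol V E m)).
  { intros m Hm. induction Hm as [|m Hm IH]; [lra|].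
    destruct (ratio_ge_1_after V E n c r Ha H Hr m Hm) as (r' & e & Hr').
    pose proof (angle_sol V E m) as K. rewrite e in K. destruct K as [_ ->].
    rewrite Rabs_mult, (Rabs_pos_eq r') by lra. nra. }
  apply is_lim_seq_spec in Hlim. destruct (Hlim (mkposreal _ Hn)) as [N HN].
  specialize (HN (max n N) ltac:(lia)). simpl in HN. rewrite Rminus_0_r in HN.
  specialize (Hg (max n N) ltac:(lia)). lra.
Qed.

Lemma bounded_nodes_stabilise V E b :
  (forall n, (nodes V E n <= b)%nat) ->
  exists c N, (c <= b)%nat /\ forall n, (N <= n)%nat -> nodes V E n = c.
Proof.
  induction b as [|b IH]; intro Hb.
  - exists O, O. split; auto. intros n _. specialize (Hb n); lia.
  - destruct (classic (forall n, (nodes V E n <= b)%nat)) as [H|H].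
    + destruct (IH H) as (c & N & Hc & HN). exists c, N. split; auto.
    + apply not_all_ex_not in H. destruct H as [N HN].
      exists (S b), N. split; auto. intros n Hn.
      pose proof (nodes_le V E N n Hn). specialize (Hb n). lia.
Qed.

(** A negative ratio, a zero ratio or [None] would each produce a node within two steps. *)
Lemma stable_nodes_ratio V E N c :
  (forall n, (N <= n)%nat -> nodes V E n = c) ->
  forall n, (N <= n)%nat -> exists r, 0 < r /\ angle V E n = (c, Some r).
Proof.
  intros H n Hn.
  pose proof (H n Hn) as H0. pose proof (H (S n) ltac:(lia)) as H1. pose proof (H (S (S n)) ltac:(lia)) as H2.
  unfold nodes in *. simpl in H1, H2.
  destruct (angle V E n) as [c' [r|]]; simpl in *; [|lia].
  subst c'. exists r. split; auto.
  destruct (Rlt_dec r 0); simpl in *; [lia|]. destruct (Req_dec_T r 0); simpl in *; [lia|lra].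
Qed.

(** If the next ratio a - 1 / r is below 1 while a >= 2 + eta, then 1 / r > 1 + eta; hence the
    squares decay geometrically. *)
Lemma ratio_lt_1_l2 V E n c eta :
  0 < eta ->
  (forall k, (n < k)%nat -> 2 + eta <= E - V k) ->
  (forall m, (n <= m)%nat -> exists r, 0 < r < 1 /\ angle V E m = (c, Some r)) ->
  in_l2 (sol V E).
Proof.
  intros Heta Ha Hr.
  set (q := / (1 + eta)).
  assert (Hq : 0 < q < 1).
  { unfold q. split; [apply Rinv_0_lt_compat; lra|]. rewrite <- Rinv_1. apply Rinv_lt_contravar; lra. }
  assert (Hs : forall m, (n <= m)%nat -> sol V E (S m) ^ 2 <= q * sol V E m ^ 2).
  { intros m Hm. destruct (Hr m Hm) as (r & Hr0 & e).
    destruct (Hr (S m) ltac:(lia)) as (r' & Hr1 & e').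
    simpl in e'. rewrite e in e'. simpl in e'.
    destruct (Rlt_dec r 0); [lra|]. destruct (Req_dec_T r 0); [lra|].
    injection e' as e'. specialize (Ha (S m) ltac:(lia)).
    assert (r < q).
    { unfold q. rewrite <- (Rinv_inv r). apply Rinv_lt_contravar; [|lra].
      apply Rmult_lt_0_compat; [lra|apply Rinv_0_lt_compat; lra]. }
    pose proof (angle_sol V E m) as K. rewrite e in K. destruct K as [_ ->].
    replace ((r * sol V E m) ^ 2) with (r * r * sol V E m ^ 2) by ring.
    apply Rmult_le_compat_r; [apply pow2_ge_0|nra]. }
  unfold in_l2. apply (ex_series_incr_n (fun k => sol V E k ^ 2) n).
  apply (ex_series_le (V := R_CompleteNormedModule) _ (fun k => sol V E n ^ 2 * q ^ k)).
  - intro k. change (norm (sol V E (n + k) ^ 2)) with (Rabs (sol V E (n + k) ^ 2)).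
    rewrite Rabs_pos_eq by apply pow2_ge_0.
    induction k as [|k IH]; [rewrite Nat.add_0_r, pow_O; lra|].
    rewrite Nat.add_succ_r. specialize (Hs (n + k)%nat ltac:(lia)).
    change (q ^ S k) with (q * q ^ k). nra.
  - apply (ex_series_scal_l (sol V E n ^ 2) (fun k => q ^ k)).
    apply ex_series_geom. rewrite Rabs_pos_eq; lra.
Qed.

Lemma tail_gap V E :
  limsup_nonpos V -> 2 < E ->
  exists n0, forall k, (n0 < k)%nat -> 2 + (E - 2) / 2 <= E - V k.
Proof.
  intros HV HE. destruct (HV ((E - 2) / 2) ltac:(lra)) as [n0 H].
  exists n0. intros k Hk. specialize (H k ltac:(lia)). lra.
Qed.

Lemma eigenvalue_ratio V E :
  limsup_nonpos V -> 2 < E -> is_eigenvalue V E ->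
  exists c N, forall n, (N <= n)%nat -> exists r, 0 < r < 1 /\ angle V E n = (c, Some r).
Proof.
  intros HV HE He. apply eigenvalue_sol_l2, l2_lim_0 in He.
  destruct (tail_gap V E HV HE) as [n0 Hn0].
  assert (Hn2 : forall k, (n0 < k)%nat -> 2 <= E - V k) by (intros k Hk; specialize (Hn0 k Hk); lra).
  destruct (bounded_nodes_stabilise V E _ (nodes_after V E n0 Hn2)) as (c & N & _ & HN).
  exists c, (max n0 N). intros n Hn.
  destruct (stable_nodes_ratio V E N c HN n ltac:(lia)) as (r & Hr & e).
  exists r. repeat split; auto.
  destruct (Rlt_or_le r 1) as [|Hr1]; auto. exfalso.
  eapply (ratio_ge_1_not_decaying V E n c r); eauto. intros k Hk; apply Hn2; lia.
Qed.

Definition eventual_nodes V E c : Prop := exists N, forall n, (N <= n)%nat -> nodes V E n = c.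

Lemma eigenvalue_eventual_nodes V E :
  limsup_nonpos V -> 2 < E -> is_eigenvalue V E -> exists c, eventual_nodes V E c.
Proof.
  intros HV HE He. destruct (eigenvalue_ratio V E HV HE He) as (c & N & H).
  exists c, N. intros n Hn. destruct (H n Hn) as (r & _ & e). unfold nodes; now rewrite e.
Qed.

Lemma eventual_nodes_mono V x y cx cy :
  eventual_nodes V x cx -> eventual_nodes V y cy -> x <= y -> (cy <= cx)%nat.
Proof.
  intros [N H] [M K] Hxy. rewrite <- (H (max N M)), <- (K (max N M)) by lia.
  now apply nodes_mono.
Qed.

(* The two ratios lie in (0, 1), where [r |-> - / r] is expanding, so their difference grows by at
   least [y - x] at each site. *)
Lemma eigenvalue_nodes_lt V x y c :
  limsup_nonpos V -> 2 < x -> x < y -> is_eigenvalue V x -> is_eigenvalue V y ->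
  eventual_nodes V x c -> eventual_nodes V y c -> False.
Proof.
  intros HV Hx Hxy Ex Ey [M HM] [M' HM'].
  destruct (eigenvalue_ratio V x HV Hx Ex) as (cx & Nx & Hrx).
  destruct (eigenvalue_ratio V y HV ltac:(lra) Ey) as (cy & Ny & Hry).
  set (N := (max (max M M') (max Nx Ny))).
  assert (H : forall k, exists rx ry, 0 < rx < 1 /\ 0 < ry < 1 /\ INR k * (y - x) <= ry - rx /\
     angle V x (N + k) = (c, Some rx) /\ angle V y (N + k) = (c, Some ry)).
  { induction k as [|k (rx & ry & Hx1 & Hy1 & Hd & ex & ey)].
    - destruct (Hrx N ltac:(lia)) as (rx & Hx1 & ex), (Hry N ltac:(lia)) as (ry & Hy1 & ey).
      pose proof (HM N ltac:(lia)) as e1; pose proof (HM' N ltac:(lia)) as e2.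
      unfold nodes in e1, e2; rewrite ex in e1; rewrite ey in e2; simpl in e1, e2; subst cx cy.
      exists rx, ry. rewrite Nat.add_0_r. repeat split; try lra; auto.
      pose proof (angle_mono V x y N ltac:(lra)) as K. rewrite ex, ey in K.
      destruct K as [K|[_ K]]; simpl in *; [lia|lra].
    - destruct (Hrx (N + S k)%nat ltac:(lia)) as (rx' & Hx1' & ex'), (Hry (N + S k)%nat ltac:(lia)) as (ry' & Hy1' & ey').
      rewrite Nat.add_succ_r in *. simpl angle in ex', ey'. rewrite ex in ex'; rewrite ey in ey'.
      simpl in ex', ey'.
      destruct (Rlt_dec rx 0); [lra|]. destruct (Req_dec_T rx 0); [lra|].
      destruct (Rlt_dec ry 0); [lra|]. destruct (Req_dec_T ry 0); [lra|].
      exists rx', ry'. rewrite S_INR. simpl angle. rewrite ex, ey. simpl.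
      destruct (Rlt_dec rx 0); [lra|]. destruct (Req_dec_T rx 0); [lra|].
      destruct (Rlt_dec ry 0); [lra|]. destruct (Req_dec_T ry 0); [lra|].
      injection ex' as -> ex'. injection ey' as _ ey'. rewrite <- ex', <- ey' in *.
      repeat split; try lra; auto.
      assert (0 <= INR k * (y - x)) by (apply Rmult_le_pos; [apply pos_INR|lra]).
      assert (ry - rx <= / rx - / ry).
      { replace (/ rx - / ry) with ((ry - rx) * / (rx * ry)) by (field; lra).
        assert (1 <= / (rx * ry)) by (rewrite <- Rinv_1; apply Rinv_le_contravar; nra). nra. }
      lra. }
  destruct (INR_unbounded (/ (y - x))) as [k Hk].
  destruct (H k) as (rx & ry & H1 & H2 & H3 & _).
  assert (1 < INR k * (y - x)).
  { apply Rmult_lt_reg_r with (/ (y - x)); [apply Rinv_0_lt_compat; lra|].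
    rewrite Rmult_assoc, Rinv_r by lra. lra. }
  lra.
Qed.

Lemma locally_ex_lt P (x : R) : locally x P -> exists y, x < y /\ P y.
Proof.
  intros [d Hd]. exists (x + d / 2). pose proof (cond_pos d). split; [lra|].
  apply Hd. unfold ball; simpl; unfold AbsRing_ball, abs, minus, plus, opp; simpl.
  rewrite Rabs_pos_eq; lra.
Qed.

(* The eigenvalue is the supremum of the energies whose solution has more than [j] nodes. *)
Lemma eigenvalue_exists V j E0 E1 n :
  limsup_nonpos V -> 2 < E0 -> (j < nodes V E0 n)%nat -> (forall m, nodes V E1 m = O) ->
  exists x, E0 <= x /\ is_eigenvalue V x /\ eventual_nodes V x j.
Proof.
  intros HV HE0 Hn HE1.
  set (Z := fun x => exists m, (j < nodes V x m)%nat).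
  assert (Hb : is_upper_bound Z E1).
  { intros x [m Hm]. destruct (Rle_or_lt x E1) as [|H]; auto.
    pose proof (nodes_mono V E1 x m ltac:(lra)). rewrite HE1 in *. lia. }
  destruct (completeness Z) as [x [Hub Hlub]]; [now exists E1|exists E0; now exists n|].
  assert (Hx0 : E0 <= x) by (apply Hub; now exists n).
  assert (Hbelow : forall P, locally x P -> exists y, P y /\ Z y).
  { intros P [d Hd]. apply NNPP. intro Hno.
    assert (x <= x - d); [|pose proof (cond_pos d); lra].
    apply Hlub. intros y Hy. destruct (Rle_or_lt y (x - d)) as [|H]; auto.
    exfalso; apply Hno. exists y; split; auto. apply Hd.
    pose proof (Hub y Hy).
    unfold ball; simpl; unfold AbsRing_ball, abs, minus, plus, opp; simpl.
    rewrite Rabs_left1; lra. }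
  (* More than [j] nodes at [x] would persist at some energy slightly above [x], against the
     supremum. *)
  assert (HnZ : forall m, (nodes V x m <= j)%nat).
  { intro m. destruct (Nat.le_gt_cases (nodes V x m) j) as [|Hm]; auto. exfalso.
    destruct (locally_ex_lt _ _ (nodes_locally V x m)) as (y & Hy & Hloc).
    assert (y <= x); [|lra]. apply Hub. exists m.
    destruct (snd (angle V x m)); lia. }
  destruct (tail_gap V x HV ltac:(lra)) as [n0 Hgap].
  assert (Htail : locally x (fun y => forall k, (n0 < k)%nat -> 2 <= y - V k)).
  { assert (Hh : 0 < (x - 2) / 2) by lra. exists (mkposreal _ Hh). intros y Hy k Hk.
    unfold ball in Hy; simpl in Hy; unfold AbsRing_ball, abs, minus, plus, opp in Hy; simpl in Hy.
    apply Rabs_def2 in Hy. specialize (Hgap k Hk). lra. }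
  destruct (bounded_nodes_stabilise V x j HnZ) as (c & N & Hc & HN).
  pose proof (stable_nodes_ratio V x N c HN) as Hr.
  set (M := max n0 N).
  (* If the ratio reached 1 at [x], it would exceed 1 strictly at the next site. By continuity an
     energy of [Z] near [x] would have ratio at least 1 there with the same count [c], so it would
     never get beyond [c <= j] nodes. *)
  assert (Hlt1 : forall m, (M <= m)%nat -> exists r, 0 < r < 1 /\ angle V x m = (c, Some r)).
  { intros m Hm. destruct (Hr m ltac:(lia)) as (r & Hr0 & e).
    exists r. repeat split; auto. destruct (Rlt_or_le r 1) as [|Hr1]; auto. exfalso.
    destruct (Hr (S m) ltac:(lia)) as (r' & Hr0' & e').
    assert (Hr1' : 1 < r').
    { simpl in e'. rewrite e in e'. simpl in e'.
      destruct (Rlt_dec r 0); [lra|]. destruct (Req_dec_T r 0); [lra|].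
      injection e' as <-. specialize (Hgap (S m) ltac:(lia)).
      assert (/ r <= / 1) by (apply Rinv_le_contravar; lra). rewrite Rinv_1 in *; lra. }
    assert (Hinc : locally x (fun y => 0 < (-1) ^ c * sol V y (S (S m)) - (-1) ^ c * sol V y (S m))).
    { apply (locally_pos (fun y => (-1) ^ c * sol V y (S (S m)) - (-1) ^ c * sol V y (S m))).
      - apply (continuous_minus (fun y => (-1) ^ c * sol V y (S (S m))) (fun y => (-1) ^ c * sol V y (S m))).
        + apply (continuous_mult (fun _ => (-1) ^ c) (fun y => sol V y (S (S m))));
            [apply continuous_const|apply continuous_sol].
        + apply (continuous_mult (fun _ => (-1) ^ c) (fun y => sol V y (S m)));
            [apply continuous_const|apply continuous_sol].
      - pose proof (angle_sol V x (S m)) as K. rewrite e' in K. destruct K as [K1 ->].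
        replace (_ - _) with ((r' - 1) * ((-1) ^ c * sol V x (S m))) by ring.
        apply Rmult_lt_0_compat; lra. }
    pose proof (angle_Some_locally V x (S m) c r' e') as Hsgn.
    pose proof (nodes_locally V x (S m)) as Hloc. rewrite e' in Hloc. simpl snd in Hloc. cbv iota in Hloc.
    destruct (Hbelow _ (filter_and _ _ (filter_and _ _ Htail Hinc) (filter_and _ _ Hsgn Hloc)))
      as (y & ((Hy1 & Hy2) & Hy3 & Hy4) & k & Hk).
    destruct (nodes_parity V y (S m) c Hy3) as [[r'' e''] _].
    rewrite Hy4, (HN (S m)) in e'' by lia.
    pose proof (angle_sol V y (S m)) as K. rewrite e'' in K. destruct K as [_ K].
    rewrite K in Hy2.
    assert (1 <= r'').
    { replace (_ - _) with ((r'' - 1) * ((-1) ^ c * sol V y (S m))) in Hy2 by ring. nra. }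
    assert (Hkc : nodes V y (max k (S m)) = c).
    { destruct (ratio_ge_1_after V y (S m) c r'' (fun k h => Hy1 k ltac:(lia)) e'' H (max k (S m)) ltac:(lia))
        as (r3 & e3 & _). unfold nodes; now rewrite e3. }
    pose proof (nodes_le V y k (max k (S m)) ltac:(lia)). lia. }
  exists x. split; [exact Hx0|]. split.
  - apply eigenvalue_sol_l2.
    apply ratio_lt_1_l2 with M c ((x - 2) / 2); auto; [lra|].
    intros k Hk; apply Hgap; lia.
  (* A nearby energy in [Z] has more than [j] nodes but at most one more than [c]; together with
     [c <= j] this gives [c = j]. *)
  - exists N. intros m Hm. rewrite (HN m Hm).
    destruct (Hlt1 M ltac:(lia)) as (r & _ & e).
    pose proof (nodes_locally V x M) as Hloc. rewrite e in Hloc. simpl snd in Hloc. cbv iota in Hloc.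
    destruct (Hbelow _ (filter_and _ _ Htail Hloc)) as (y & (Hy1 & Hy2) & k & Hk).
    pose proof (nodes_after V y M (fun k h => Hy1 k ltac:(lia)) k).
    rewrite Hy2, (HN M) in * by lia. lia.
Qed.
(** * Node counts for the potential *)

(** Two sites at energy 2, starting from ratio 1 - z. The first-order contributions of + p and - p /
    (1 - p) cancel, so the ratio loses only a second-order amount, at most 8 P ^ 2. *)
Lemma pair_upper p P z :
  0 <= p <= P -> P <= 1 / 32 -> 0 <= z <= P ->
  0 < 2 + p - / (1 - z) /\
  1 - (z + 8 * P ^ 2) <= 2 - p / (1 - p) - / (2 + p - / (1 - z)).
Proof.
  intros Hp HP Hz.
  set (D := 1 - 2 * z + p * (1 - z)).
  assert (HD : 15 / 16 <= D) by (unfold D; nra).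
  assert (e : 2 + p - / (1 - z) = D / (1 - z)) by (unfold D; field; lra).
  rewrite e. split; [apply Rdiv_lt_0_compat; lra|].
  replace (/ (D / (1 - z))) with ((1 - z) / D) by (field; lra).
  assert (H1 : p / (1 - p) <= p + 2 * p ^ 2).
  { apply Rmult_le_reg_r with (1 - p); [lra|]. replace (p / (1 - p) * (1 - p)) with p by (field; lra). nra. }
  assert (H2 : (1 - z) / D <= 1 + z - p - 2 * p ^ 2 + 8 * P ^ 2).
  { apply Rmult_le_reg_r with D; [lra|]. replace ((1 - z) / D * D) with (1 - z) by (field; lra).
    assert (p ^ 2 <= P ^ 2) by nra. assert (z ^ 2 <= P ^ 2) by nra.
    assert (6 * P ^ 2 * (15 / 16) <= (8 * P ^ 2 - 2 * p ^ 2) * D) by nra.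
    assert ((1 + z - p) * D - (1 - z) >= - 2 * z ^ 2 - p ^ 2 - p * z ^ 2) by (unfold D; nra).
    nra. }
  lra.
Qed.

(** With ratio 1 + s and eps = 0, the pair of sites lowers s by 2 (s ^ 2 + s p + p ^ 2) to second
    order, a positive definite form. The constants 3 / 4 and 1 / 2 leave room for eps and the
    higher-order terms. *)
Lemma pair_lower p eps s :
  0 < p <= 1 / 32 -> 0 <= eps <= p ^ 2 / 16 -> - (2 / 5) <= s <= 2 / 3 ->
  0 < 2 + eps + p - / (1 + s) /\
  2 + eps - p / (1 - p) - / (2 + eps + p - / (1 + s)) <= 1 + s - (3 / 4 * s ^ 2 + p ^ 2 / 2).
Proof.
  intros Hp He Hs.
  set (D := 1 + 2 * s + (p + eps) * (1 + s)).
  assert (HD : 0 < D) by (unfold D; nra).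
  assert (e : 2 + eps + p - / (1 + s) = D / (1 + s)) by (unfold D; field; lra).
  rewrite e. split; [apply Rdiv_lt_0_compat; lra|].
  replace (/ (D / (1 + s))) with ((1 + s) / D) by (field; lra).
  assert (H1 : p + p ^ 2 <= p / (1 - p)).
  { apply Rmult_le_reg_r with (1 - p); [lra|]. replace (p / (1 - p) * (1 - p)) with p by (field; lra). nra. }
  assert (H2 : 1 - s - p - p ^ 2 / 2 + 3 / 4 * s ^ 2 + eps <= (1 + s) / D).
  { apply Rmult_le_reg_r with D; [lra|]. replace ((1 + s) / D * D) with (1 + s) by (field; lra).
    (* [F0] and [D0] are the factors at eps = 0; the eps terms of the product are bounded separately
       by 6 p ^ 2 / 16. *)
    set (F0 := 1 - s - p - p ^ 2 / 2 + 3 / 4 * s ^ 2).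
    set (D0 := 1 + 2 * s + p * (1 + s)).
    assert (HF : 0 <= F0 <= 2) by (unfold F0; nra).
    assert (HD0 : 0 <= D0 <= 5/2) by (unfold D0; nra).
    assert (HE : (F0 + eps) * (D0 + eps * (1 + s)) <= F0 * D0 + p ^ 2 / 16 * 6).
    { assert (HF2 : F0 * (1 + s) <= 10 / 3) by nra.
      assert (eps * (1 + s) <= 1 / 100) by nra.
      assert (eps * (D0 + F0 * (1 + s) + eps * (1 + s)) <= p ^ 2 / 16 * 6).
      { apply Rmult_le_compat; nra. }
      lra. }
    assert (HM : F0 * D0 + p ^ 2 / 16 * 6 <= 1 + s).
    { unfold F0, D0.
      assert (Hq : 0 <= p ^ 2) by apply pow2_ge_0.
      assert (Hss : 0 <= s ^ 2) by apply pow2_ge_0.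
      assert (Hp3 : 0 <= p ^ 3 <= p ^ 2 / 32) by nra.
      assert (Hps : 0 <= p * s ^ 2 <= s ^ 2 / 32) by nra.
      destruct (Rle_or_lt 0 s).
      - assert (0 <= s ^ 3 <= 2 / 3 * s ^ 2) by nra.
        assert (p * s ^ 3 <= 2 / 3 * (p * s ^ 2)) by nra.
        assert (0 <= s * p) by nra. assert (0 <= p ^ 2 * s) by nra. assert (0 <= p ^ 3 * s) by nra.
        lra.
      - assert (s ^ 3 <= 0) by nra. assert (p * s ^ 3 <= 0) by nra.
        assert (- (p ^ 2 * s) <= - (p * s) / 32) by nra. assert (- (p ^ 3 * s) <= p ^ 3) by nra.
        (* For s < 0 the mixed term in s p has the unfavourable sign; this square controls it. *)
        pose proof (pow2_ge_0 (s + 9 / 10 * p)).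
        lra. }
    replace D with (D0 + eps * (1 + s)) by (unfold D, D0; ring).
    replace (1 - s - p - p ^ 2 / 2 + 3 / 4 * s ^ 2 + eps) with (F0 + eps) by (unfold F0; ring).
    lra. }
  lra.
Qed.

(* [1 + 2 / a - 2 / b] with [a + b] fixed imitates the tangent solving [s' = - s ^ 2 - p ^ 2]: it
   falls from infinity to -infinity within the length [a + b]. *)
Lemma pair_lower_next p a b :
  3 <= a -> 6 <= b -> 120 <= (p * (a + b)) ^ 2 ->
  let s := 2 / a - 2 / b in
  s - (3 / 4 * s ^ 2 + p ^ 2 / 2) <= 2 / (a + 1) - 2 / (b - 1).
Proof.
  intros Ha Hb Hp s.
  set (x := / a). set (y := / b).
  assert (Hx : 0 < x) by (apply Rinv_0_lt_compat; lra).
  assert (Hy : 0 < y) by (apply Rinv_0_lt_compat; lra).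
  assert (Hax : a * x = 1) by (unfold x; field; lra).
  assert (Hby : b * y = 1) by (unfold y; field; lra).
  assert (es : s = 2 * x - 2 * y) by (unfold s, x, y; field; lra).
  assert (H1 : 2 / a - 2 / (a + 1) <= 2 * x ^ 2).
  { replace (2 / a - 2 / (a + 1)) with (2 * x * / (a + 1)) by (unfold x; field; lra).
    assert (/ (a + 1) <= x) by (apply Rinv_le_contravar; lra). nra. }
  assert (H2 : 2 / (b - 1) - 2 / b <= 12 / 5 * y ^ 2).
  { replace (2 / (b - 1) - 2 / b) with (2 * y * / (b - 1)) by (unfold y; field; lra).
    assert (/ (b - 1) <= 6 / 5 * y).
    { apply Rmult_le_reg_r with (b - 1); [lra|]. rewrite Rinv_l by lra.
      replace (6 / 5 * y * (b - 1)) with (6 / 5 * (b * y - y)) by ring. rewrite Hby.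
      assert (y <= / 6) by (apply Rinv_le_contravar; lra). lra. }
    nra. }
  assert (H3 : 2 * x ^ 2 + 12 / 5 * y ^ 2 <= 3 * (x - y) ^ 2 + p ^ 2 / 2).
  { assert (Hpp : 0 <= p ^ 2) by apply pow2_ge_0.
    (* The larger of a and b is at least half of a + b, so its inverse square is at most p ^ 2 /
       30. *)
    destruct (Rle_or_lt a b) as [h|h].
    - assert (30 * y ^ 2 <= p ^ 2).
      { assert (120 <= p ^ 2 * (2 * b) ^ 2).
        { apply Rle_trans with (1 := Hp). rewrite Rpow_mult_distr.
          apply Rmult_le_compat_l; auto. apply pow_incr; lra. }
        replace (p ^ 2) with (p ^ 2 * (b * y) ^ 2) by (rewrite Hby; ring).
        assert (0 <= y ^ 2) by apply pow2_ge_0. nra. }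
      pose proof (pow2_ge_0 (x - 3 * y)). nra.
    - assert (30 * x ^ 2 <= p ^ 2).
      { assert (120 <= p ^ 2 * (2 * a) ^ 2).
        { apply Rle_trans with (1 := Hp). rewrite Rpow_mult_distr.
          apply Rmult_le_compat_l; auto. apply pow_incr; lra. }
        replace (p ^ 2) with (p ^ 2 * (a * x) ^ 2) by (rewrite Hax; ring).
        assert (0 <= x ^ 2) by apply pow2_ge_0. nra. }
      pose proof (pow2_ge_0 (y - 5 * x)). nra. }
  replace (2 / (a + 1) - 2 / (b - 1)) with (s - (2 / a - 2 / (a + 1)) - (2 / (b - 1) - 2 / b))
    by (unfold s; ring).
  replace (3 / 4 * s ^ 2) with (3 * (x - y) ^ 2) by (rewrite es; field).
  lra.
Qed.

(** The alternating 32 / m and - 32 / (m + 32), rewritten in terms of the site. The value -1 at site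
    0 fits the boundary condition to the solutions at both energies 0 and -2. *)
Definition pot (n : nat) : R :=
  match n with
  | O => -1
  | _ => if Nat.even n then 64 / INR n else - (64 / (INR n + 65))
  end.

Lemma pot_odd m : pot (S (2 * m)) = - (32 / (INR m + 33)).
Proof.
  unfold pot. replace (Nat.even (S (2 * m))) with false.
  - rewrite S_INR, mult_INR. simpl (INR 2). pose proof (pos_INR m). field. lra.
  - symmetry. rewrite Nat.even_succ, Nat.odd_mul. reflexivity.
Qed.

Lemma pot_even m : pot (S (S (2 * m))) = 32 / (INR m + 1).
Proof.
  unfold pot. replace (Nat.even (S (S (2 * m)))) with true.
  - rewrite !S_INR, mult_INR. simpl (INR 2). pose proof (pos_INR m). field. lra.
  - symmetry. change (Nat.even (2 * m) = true). rewrite Nat.even_mul. reflexivity.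
Qed.

Lemma pot_le n : (0 < n)%nat -> pot n <= 64 / INR n.
Proof.
  intro Hn. unfold pot. destruct n as [|n]; [lia|].
  assert (0 < INR (S n)) by (apply lt_0_INR; lia).
  assert (0 < 64 / INR (S n)) by (apply Rdiv_lt_0_compat; lra).
  assert (0 < 64 / (INR (S n) + 65)) by (apply Rdiv_lt_0_compat; lra).
  destruct (Nat.even (S n)); lra.
Qed.

Lemma pot_le_64 n : pot n <= 64.
Proof.
  destruct n as [|n]; [simpl; lra|].
  apply Rle_trans with (1 := pot_le (S n) ltac:(lia)).
  assert (1 <= INR (S n)) by (rewrite S_INR; pose proof (pos_INR n); lra).
  apply Rmult_le_reg_r with (INR (S n)); [lra|]. unfold Rdiv.
  rewrite Rmult_assoc, Rinv_l by lra. lra.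
Qed.

Lemma pot_le_eps n eps : 0 < eps -> 64 / eps <= INR n -> pot n <= eps.
Proof.
  intros He Hn.
  assert (0 < 64 / eps) by (apply Rdiv_lt_0_compat; lra).
  assert (0 < n)%nat by (apply INR_lt; simpl; lra).
  apply Rle_trans with (1 := pot_le n ltac:(lia)).
  apply Rmult_le_reg_r with (INR n / eps); [apply Rdiv_lt_0_compat; lra|].
  replace (64 / INR n * (INR n / eps)) with (64 / eps) by (field; lra).
  replace (eps * (INR n / eps)) with (INR n) by (field; lra). exact Hn.
Qed.

Lemma pot_limsup : limsup_nonpos pot.
Proof.
  intros eps He. destruct (INR_unbounded (64 / eps)) as [n0 Hn0].
  exists n0. intros n Hn. apply pot_le_eps; auto.
  apply le_INR in Hn. lra.
Qed.

(* [odd_depth m] is 1 - q_(m+1): the sites 2m+1 and 2m+2 carry [- p] and [p / (1 - p)] for [p = odd_depth m]. *)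
Definition odd_depth (m : nat) : R := 32 / (INR m + 33).

Lemma pp_le_inv m x : 0 < x -> 32 * x <= INR m + 33 -> odd_depth m <= / x.
Proof.
  intros Hx H. unfold odd_depth. apply Rmult_le_reg_r with (x * (INR m + 33)); [apply Rmult_lt_0_compat; lra|].
  replace (32 / (INR m + 33) * (x * (INR m + 33))) with (32 * x) by (field; lra).
  replace (/ x * (x * (INR m + 33))) with (INR m + 33) by (field; lra). exact H.
Qed.

Lemma angle_pair E m :
  angle pot E (2 * S m) =
  step (E - odd_depth m / (1 - odd_depth m)) (step (E + odd_depth m) (angle pot E (2 * m))).
Proof.
  replace (2 * S m)%nat with (S (S (2 * m))) by lia.
  change (angle pot E (S (S (2 * m)))) with
    (step (E - pot (S (S (2 * m)))) (step (E - pot (S (2 * m))) (angle pot E (2 * m)))).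
  rewrite pot_odd, pot_even. unfold odd_depth. pose proof (pos_INR m).
  f_equal; [|f_equal; ring].
  f_equal. field. lra.
Qed.

Lemma pair_step_lower E m c t t' :
  angle_le (c, Some t) (angle pot E (2 * m)) -> 0 < t -> 0 < E + odd_depth m - / t ->
  E - odd_depth m / (1 - odd_depth m) - / (E + odd_depth m - / t) <= t' ->
  angle_le (c, Some t') (angle pot E (2 * S m)).
Proof.
  intros H H0 H1 H2. rewrite angle_pair.
  apply step_lower with (E + odd_depth m - / t); auto.
  apply step_lower with t; auto. lra.
Qed.

Lemma IZR_le_INR (k n : nat) : (k <= n)%nat -> IZR (Z.of_nat k) <= INR n.
Proof. intro H. rewrite <- INR_IZR_INZ. now apply le_INR. Qed.

(** The tangent-like barrier of [pair_lower_next], with a = k + 3 and b = L - 3 - k of sum L,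
    followed through the block of pairs from L to 2 L. *)
Lemma dyadic_lower_comparison E L c k :
  (1024 <= L)%nat -> 2 <= E <= 2 + / INR L ^ 2 -> c = nodes pot E (2 * L) ->
  (k + 9 <= L)%nat ->
  angle_le (c, Some (1 + (2 / (INR k + 3) - 2 / (INR L - 3 - INR k)))) (angle pot E (2 * (S L + k))).
Proof.
  intros HL HE Hc. assert (HLr : 1024 <= INR L) by exact (IZR_le_INR 1024 L HL).
  assert (HLi : 0 < / INR L) by (apply Rinv_0_lt_compat; lra).
  assert (HL2 : / INR L ^ 2 <= / 1024).
  { apply Rinv_le_contravar; nra. }
  induction k as [|k IH]; intro Hk.
  - rewrite Nat.add_0_r, angle_pair.
    assert (Hp : 0 < odd_depth L <= / 31).
    { split; [apply Rdiv_lt_0_compat; lra|apply pp_le_inv; lra]. }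
    assert (Hpq : 0 < odd_depth L / (1 - odd_depth L)) by (apply Rdiv_lt_0_compat; lra).
    (* Two steps from an arbitrary state give a barrier of about 2 - 2 / 5, which lies below the
       starting value at a = 3. *)
    apply step_lower with (E + odd_depth L); [rewrite Hc; apply step_lower_fst; lra|lra|].
    assert (/ 3 <= / (E + odd_depth L)) by (apply Rinv_le_contravar; lra).
    simpl (INR 0). assert (/ (INR L - 3) <= / 1000) by (apply Rinv_le_contravar; lra).
    replace (INR L - 3 - 0) with (INR L - 3) by ring.
    assert (H25 : 2/5 <= / (E + odd_depth L)).
    { replace (2/5) with (/ (5/2)) by field. apply Rinv_le_contravar; lra. }
    lra.
  - rewrite Nat.add_succ_r. specialize (IH ltac:(lia)).
    set (m := (S L + k)%nat) in *.
    assert (Hm : INR m = INR L + 1 + INR k) by (unfold m; rewrite plus_INR, S_INR; ring).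
    assert (HkL : INR k + 10 <= INR L).
    { apply le_INR in Hk. rewrite plus_INR, S_INR in Hk. simpl in Hk. lra. }
    pose proof (pos_INR k) as Hk0.
    set (a := INR k + 3) in *. set (b := INR L - 3 - INR k) in *.
    assert (Hab : a + b = INR L) by (unfold a, b; ring).
    assert (Hp : 0 < odd_depth m <= / 32).
    { split; [apply Rdiv_lt_0_compat; lra|apply pp_le_inv; lra]. }
    (* This is overcriticality: 15 ^ 2 exceeds both the 120 of [pair_lower_next] and the 16 that
       makes the energy excess 1 / L ^ 2 admissible in [pair_lower]. *)
    assert (HpL : 15 <= odd_depth m * INR L).
    { unfold odd_depth. apply Rmult_le_reg_r with (INR m + 33); [lra|].
      replace (32 / (INR m + 33) * INR L * (INR m + 33)) with (32 * INR L) by (field; lra). lra. }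
    assert (He : 0 <= E - 2 <= odd_depth m ^ 2 / 16).
    { split; [lra|]. apply Rle_trans with (/ INR L ^ 2); [lra|].
      apply Rmult_le_reg_r with (INR L ^ 2); [nra|]. rewrite Rinv_l by nra.
      replace (odd_depth m ^ 2 / 16 * INR L ^ 2) with ((odd_depth m * INR L) ^ 2 / 16) by field.
      nra. }
    assert (Hia : 0 < 2 / a <= 2 / 3).
    { split; [apply Rdiv_lt_0_compat; unfold a; lra|].
      apply Rmult_le_compat_l; [lra|]. apply Rinv_le_contravar; unfold a; lra. }
    assert (Hib : 0 < 2 / b <= 2 / 5).
    { split; [apply Rdiv_lt_0_compat; unfold b; lra|].
      apply Rmult_le_compat_l; [lra|]. apply Rinv_le_contravar; unfold b; lra. }
    destruct (pair_lower (odd_depth m) (E - 2) (2 / a - 2 / b) ltac:(lra) He ltac:(lra)) as [K1 K2].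
    pose proof (pair_lower_next (odd_depth m) a b ltac:(unfold a; lra) ltac:(unfold b; lra)
                  ltac:(rewrite Hab; nra)) as K3.
    cbv zeta in K3.
    eapply pair_step_lower; [exact IH|lra|lra|].
    rewrite S_INR. replace (INR k + 1 + 3) with (a + 1) by (unfold a; ring).
    replace (INR L - 3 - (INR k + 1)) with (b - 1) by (unfold b; ring).
    replace (2 + (E - 2)) with E in K2 by ring. lra.
Qed.

(** At k = L - 9, where b = 6, the barrier is down to about 2 / 3. One more pair brings it to 1 / 3,
    the next site makes it negative, and this forces a node before site 4 L. *)
Lemma nodes_dyadic_lower E L :
  (1024 <= L)%nat -> 2 <= E <= 2 + / INR L ^ 2 ->
  (S (nodes pot E (2 * L)) <= nodes pot E (2 * (2 * L)))%nat.
Proof.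
  intros HL HE. assert (HLr : 1024 <= INR L) by exact (IZR_le_INR 1024 L HL).
  pose proof (dyadic_lower_comparison E L _ (L - 9) HL HE eq_refl ltac:(lia)) as H.
  rewrite minus_INR in H by lia. replace (INR 9) with 9 in H by (simpl; ring).
  assert (HL2 : / INR L ^ 2 <= / 1024) by (apply Rinv_le_contravar; nra).
  set (m := (S L + (L - 9))%nat) in *.
  assert (Hm : INR m = 2 * INR L - 8).
  { unfold m. rewrite plus_INR, S_INR, minus_INR by lia. simpl (INR 9). ring. }
  assert (Hm1 : INR (S m) = 2 * INR L - 7) by (rewrite S_INR; lra).
  assert (Hp : 0 < odd_depth m <= / 32).
  { split; [apply Rdiv_lt_0_compat; lra|apply pp_le_inv; lra]. }
  assert (Hp1 : 0 < odd_depth (S m) <= / 32).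
  { split; [apply Rdiv_lt_0_compat; lra|apply pp_le_inv; lra]. }
  assert (Hpq : 0 < odd_depth m / (1 - odd_depth m)) by (apply Rdiv_lt_0_compat; lra).
  (* So the coefficient at the second site of the pair is at most 2. *)
  assert (HepsP : / INR L ^ 2 <= odd_depth m / (1 - odd_depth m)).
  { apply Rle_trans with (odd_depth m).
    - unfold odd_depth. rewrite Hm. apply Rmult_le_reg_r with ((2 * INR L - 8 + 33) * INR L ^ 2); [nra|].
      replace (/ INR L ^ 2 * ((2 * INR L - 8 + 33) * INR L ^ 2)) with (2 * INR L - 8 + 33) by (field; lra).
      replace (32 / (2 * INR L - 8 + 33) * ((2 * INR L - 8 + 33) * INR L ^ 2)) with (32 * INR L ^ 2) by (field; lra).
      nra.
    - apply Rmult_le_reg_r with (1 - odd_depth m); [lra|]. unfold Rdiv. rewrite Rmult_assoc, Rinv_l by lra. nra. }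
  assert (Ht : / (INR L - 6) <= / 1000) by (apply Rinv_le_contravar; lra).
  assert (Ht0 : 0 < / (INR L - 6)) by (apply Rinv_0_lt_compat; lra).
  replace (1 + (2 / (INR L - 9 + 3) - 2 / (INR L - 3 - (INR L - 9)))) with (2 / 3 + 2 * / (INR L - 6)) in H
    by (field; lra).
  assert (H1 : angle_le (nodes pot E (2 * L), Some (2 / 3 + 1 / 500)) (angle pot E (2 * m))).
  { apply angle_le_trans with (2 := H). right; simpl; split; auto; lra. }
  assert (H2 : angle_le (nodes pot E (2 * L), Some (1 / 3)) (angle pot E (2 * S m))).
  { apply pair_step_lower with (1 := H1); [lra| |].
    - replace (/ (2 / 3 + 1 / 500)) with (1500 / 1003) by field. lra.
    - replace (/ (2 / 3 + 1 / 500)) with (1500 / 1003) by field.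
      assert (4 / 7 * 3 <= / (E + odd_depth m - 1500 / 1003)); [|lra].
      replace (4 / 7 * 3) with (/ (7 / 12)) by field. apply Rinv_le_contravar; lra. }
  assert (H3 : (S (nodes pot E (2 * L)) <= nodes pot E (2 * S (S m)))%nat).
  { unfold nodes at 2. rewrite angle_pair. apply step_node with (E + odd_depth (S m) - / (1 / 3)).
    - apply step_lower with (1 / 3); auto; lra.
    - replace (/ (1 / 3)) with 3 by field. lra. }
  apply Nat.le_trans with (1 := H3). apply nodes_le. unfold m; lia.
Qed.

(** One node is allowed for the first pair; then the barrier descends by 8 P ^ 2 per pair. The
    condition 8 P l <= 1 keeps the total descent within P, as [pair_upper] requires. *)
Lemma subblock_upper_comparison E M l P k :
  (2 <= E) -> P = odd_depth M -> P <= 1 / 32 -> 8 * P * INR l <= 1 -> (k < l)%nat ->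
  angle_le (angle pot E (2 * (S M + k))) (S (nodes pot E (2 * M)), Some (1 - 8 * P ^ 2 * INR k)).
Proof.
  intros HE HP HP32 Hl.
  assert (HP0 : 0 < P) by (rewrite HP; apply Rdiv_lt_0_compat; pose proof (pos_INR M); lra).
  induction k as [|k IH]; intro Hk.
  - rewrite Nat.add_0_r, angle_pair, <- HP. simpl (INR 0). rewrite Rmult_0_r, Rminus_0_r.
    apply step_upper with 2; [|lra|].
    + apply step_upper_S; [unfold nodes; lia|lra].
    + assert (P / (1 - P) <= 1 / 31).
      { apply Rmult_le_reg_r with (1 - P); [lra|]. unfold Rdiv. rewrite Rmult_assoc, Rinv_l by lra. lra. }
      lra.
  - rewrite Nat.add_succ_r. specialize (IH ltac:(lia)).
    set (m := (S M + k)%nat) in *.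
    assert (Hm : INR m = INR M + 1 + INR k) by (unfold m; rewrite plus_INR, S_INR; ring).
    pose proof (pos_INR M) as HM. pose proof (pos_INR k) as Hk0.
    assert (Hp : 0 <= odd_depth m <= P).
    { split; [apply Rlt_le, Rdiv_lt_0_compat; lra|].
      rewrite HP. unfold odd_depth. apply Rmult_le_compat_l; [lra|]. apply Rinv_le_contravar; lra. }
    assert (Hz : 0 <= 8 * P ^ 2 * INR k <= P).
    { assert (INR k <= INR l) by (apply le_INR; lia). split; [nra|].
      replace (8 * P ^ 2 * INR k) with (P * (8 * P * INR k)) by ring.
      assert (8 * P * INR k <= 1) by nra. nra. }
    destruct (pair_upper (odd_depth m) P (8 * P ^ 2 * INR k) Hp HP32 Hz) as [K1 K2].
    rewrite angle_pair.
    apply step_upper with (2 + odd_depth m - / (1 - 8 * P ^ 2 * INR k)); auto.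
    + apply step_upper with (1 - 8 * P ^ 2 * INR k); auto; lra.
    + rewrite S_INR. lra.
Qed.

(** The bound 992 gives [odd_depth M <= 1 / 32], and 256 l <= M gives 8 P l <= 1. *)
Lemma nodes_subblock_upper E M l :
  2 <= E -> (992 <= M)%nat -> (256 * l <= M)%nat ->
  (nodes pot E (2 * (M + l)) <= S (nodes pot E (2 * M)))%nat.
Proof.
  intros HE HM Hl. destruct l as [|l]; [rewrite Nat.add_0_r; lia|].
  apply angle_le_fst with (s' := (S (nodes pot E (2 * M)), Some (1 - 8 * odd_depth M ^ 2 * INR l))).
  replace (M + S l)%nat with (S M + l)%nat by lia.
  assert (HMr : 992 <= INR M) by exact (IZR_le_INR 992 M HM).
  apply subblock_upper_comparison with (S l); auto.
  - replace (1 / 32) with (/ 32) by field. apply pp_le_inv; lra.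
  - apply le_INR in Hl. rewrite mult_INR in Hl.
    replace (INR 256) with 256 in Hl by (rewrite INR_IZR_INZ; reflexivity).
    unfold odd_depth. apply Rmult_le_reg_r with (INR M + 33); [lra|].
    replace (8 * (32 / (INR M + 33)) * INR (S l) * (INR M + 33)) with (256 * INR (S l)) by (field; lra). lra.
Qed.

Lemma nodes_pow2_lower E J i :
  2 <= E <= 2 + / INR (2 ^ (10 + J)) ^ 2 -> (i <= S J)%nat ->
  (i <= nodes pot E (2 * 2 ^ (10 + i)))%nat.
Proof.
  intros HE. induction i as [|i IH]; intro Hi; [lia|].
  specialize (IH ltac:(lia)).
  replace (10 + S i)%nat with (S (10 + i)) by lia. rewrite Nat.pow_succ_r'.
  assert (HL : (1024 <= 2 ^ (10 + i))%nat).
  { change 1024%nat with (2 ^ 10)%nat. apply Nat.pow_le_mono_r; lia. }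
  apply Nat.le_trans with (S (nodes pot E (2 * 2 ^ (10 + i)))); [lia|].
  apply nodes_dyadic_lower; auto. split; [lra|].
  apply Rle_trans with (1 := proj2 HE). apply Rplus_le_compat_l.
  assert (Hpos : 0 < INR (2 ^ (10 + i))) by (apply lt_0_INR; lia).
  apply Rinv_le_contravar; [apply pow_lt; auto|].
  apply pow_incr. split; [lra|]. apply le_INR, Nat.pow_le_mono_r; lia.
Qed.

(** Each doubling is cut into 256 subblocks carrying at most one node each; the initial stretch has
    at most one node per site. *)
Lemma nodes_pow2_upper E i :
  2 <= E -> (nodes pot E (2 * 2 ^ (10 + i)) <= 2 * 2 ^ 10 + 256 * i)%nat.
Proof.
  intro HE. induction i as [|i IH].
  - rewrite Nat.mul_0_r, !Nat.add_0_r. apply nodes_le_index.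
  - assert (Hpow : (2 ^ (10 + i) = 256 * (4 * 2 ^ i))%nat).
    { rewrite Nat.pow_add_r. change (2 ^ 10)%nat with (256 * 4)%nat. now rewrite <- Nat.mul_assoc. }
    set (l := (4 * 2 ^ i)%nat) in *.
    assert (Hl : (4 <= l)%nat) by (unfold l; pose proof (Nat.pow_nonzero 2 i); lia).
    replace (10 + S i)%nat with (S (10 + i)) by lia. rewrite Nat.pow_succ_r'.
    assert (Hr : forall r, (nodes pot E (2 * (2 ^ (10 + i) + r * l)) <= nodes pot E (2 * 2 ^ (10 + i)) + r)%nat).
    { induction r as [|r IHr]; [rewrite Nat.mul_0_l, !Nat.add_0_r; lia|].
      replace (2 ^ (10 + i) + S r * l)%nat with ((2 ^ (10 + i) + r * l) + l)%nat by lia.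
      pose proof (nodes_subblock_upper E (2 ^ (10 + i) + r * l) l HE ltac:(lia) ltac:(lia)). lia. }
    specialize (Hr 256%nat).
    replace (2 ^ (10 + i) + 256 * l)%nat with (2 * 2 ^ (10 + i))%nat in Hr by lia.
    lia.
Qed.

(** Past site 2 * 2 ^ (10 + i) the potential is below the energy excess, so at most one further node
    occurs. *)
Lemma nodes_upper E i n :
  2 + 64 * (1 / 2) ^ i <= E -> (nodes pot E n <= S (2 * 2 ^ 10 + 256 * i))%nat.
Proof.
  intro HE. assert (Hi : 0 < (1 / 2) ^ i) by (apply pow_lt; lra).
  apply Nat.le_trans with (S (nodes pot E (2 * 2 ^ (10 + i)))).
  - apply nodes_after. intros k Hk.
    enough (pot k <= 64 * (1 / 2) ^ i) by lra.
    apply pot_le_eps; [lra|].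
    replace (64 / (64 * (1 / 2) ^ i)) with (INR (2 ^ i)).
    + apply le_INR. apply Nat.le_trans with (2 ^ (10 + i))%nat; [apply Nat.pow_le_mono_r|]; lia.
    + rewrite pow_INR. replace (INR 2) with 2 by (simpl; ring). replace (1 / 2) with (/ 2) by field. rewrite pow_inv.
      field. apply pow_nonzero; lra.
  - pose proof (nodes_pow2_upper E i ltac:(lra)). lia.
Qed.

(** * Size of the eigenvalues above 2 and geometric decay *)

Lemma nodes_above_bound V E : (forall n, 2 <= E - V n) -> forall n, nodes V E n = O.
Proof.
  intros H n.
  destruct (ratio_ge_1_after V E 0 0 (E - V O) (fun k _ => H k) eq_refl ltac:(specialize (H O); lra) n ltac:(lia))
    as (r & e & _).
  unfold nodes; now rewrite e.
Qed.

Lemma eigenvalue_le_bound V E v : (forall n, V n <= v) -> is_eigenvalue V E -> E <= v + 2.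
Proof.
  intros Hv He. destruct (Rle_or_lt E (v + 2)) as [|H]; auto. exfalso.
  apply eigenvalue_sol_l2, l2_lim_0 in He.
  apply (ratio_ge_1_not_decaying V E 0 0 (E - V O)); auto.
  - intros k _. specialize (Hv k). lra.
  - specialize (Hv O). lra.
Qed.

(** The lower energy is 2 + 1 / L ^ 2 with L = 2 ^ (10 + j), where [j + 1] dyadic blocks supply more
    than [j] nodes; at 66 = 64 + 2 there are none. *)
Lemma pot_eigenvalue j :
  exists x, 2 + (1 / 4) ^ (10 + j) <= x /\ is_eigenvalue pot x /\ eventual_nodes pot x j.
Proof.
  assert (Hpos : 0 < (1 / 4) ^ (10 + j)) by (apply pow_lt; lra).
  apply (eigenvalue_exists pot j _ 66 (2 * 2 ^ (10 + S j))).
  - exact pot_limsup.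
  - lra.
  - apply (nodes_pow2_lower _ j); [|lia]. split; [lra|]. apply Req_le. f_equal.
    rewrite pow_INR. replace (INR 2) with 2 by (simpl; ring). rewrite <- pow_mult, Nat.mul_comm, pow_mult.
    replace (1 / 4) with (/ (2 ^ 2)) by field. now rewrite pow_inv.
  - apply nodes_above_bound. intro n. pose proof (pot_le_64 n). lra.
Qed.

Lemma pot_eigenvalue_upper x k i :
  is_eigenvalue pot x -> eventual_nodes pot x k ->
  (S (2 * 2 ^ 10 + 256 * i) < k)%nat -> x - 2 <= 64 * (1 / 2) ^ i.
Proof.
  intros He [N HN] Hk.
  destruct (Rle_or_lt (x - 2) (64 * (1 / 2) ^ i)) as [|H]; auto. exfalso.
  pose proof (nodes_upper x i N ltac:(lra)). rewrite HN in *; lia.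
Qed.

Lemma bernoulli_sub x n : 0 <= x <= 1 -> 1 - INR n * x <= (1 - x) ^ n.
Proof.
  intro Hx. induction n as [|n IH]; [simpl; lra|].
  rewrite S_INR. change ((1 - x) ^ S n) with ((1 - x) * (1 - x) ^ n).
  pose proof (pos_INR n). nra.
Qed.

(** Halving every m indices is geometric decay: by Bernoulli, c = 1 - 1 / (2 m) satisfies c ^ m >= 1
    / 2. The factor c ^ B in the constant absorbs the offset D and the rounding. *)
Lemma geometric_of_halving a A m D :
  (0 < m)%nat -> 0 < A -> (forall k, a k <= A) ->
  (forall k i, (D + m * i < k)%nat -> a k <= A * (1 / 2) ^ i) ->
  exists C c, 0 < C /\ 1 / 2 <= c < 1 /\ forall k, a k <= C * c ^ S k.
Proof.
  intros Hm HA H0 H1.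
  assert (HmR : 1 <= INR m) by (apply (le_INR 1); lia).
  set (x := / (2 * INR m)).
  assert (Hx : 0 < x <= / 2).
  { split; [apply Rinv_0_lt_compat; lra|apply Rinv_le_contravar; lra]. }
  set (c := 1 - x).
  assert (Hc : 1 / 2 <= c < 1) by (unfold c; lra).
  assert (Hcm : 1 / 2 <= c ^ m).
  { pose proof (bernoulli_sub x m ltac:(lra)) as B.
    replace (1 - INR m * x) with (1 / 2) in B by (unfold x; field; lra). exact B. }
  assert (Hcd : forall d d', (d <= d')%nat -> c ^ d' <= c ^ d).
  { intros d d' Hd. induction Hd as [|d' Hd IH]; [lra|].
    assert (0 < c ^ d') by (apply pow_lt; lra). change (c ^ S d') with (c * c ^ d'). nra. }
  set (B := (D + m + 1)%nat).
  assert (HB : 0 < c ^ B) by (apply pow_lt; lra).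
  exists (A / c ^ B), c. split; [apply Rdiv_lt_0_compat; auto|]. split; auto.
  assert (Hgen : forall k i, (S k <= B + m * i)%nat -> A * (1 / 2) ^ i <= A / c ^ B * c ^ S k).
  { intros k i Hk. apply Rle_trans with (A / c ^ B * c ^ (B + m * i)).
    - rewrite pow_add, pow_mult.
      replace (A / c ^ B * (c ^ B * (c ^ m) ^ i)) with (A * (c ^ m) ^ i) by (field; lra).
      apply Rmult_le_compat_l; [lra|]. apply pow_incr. lra.
    - apply Rmult_le_compat_l; [apply Rlt_le, Rdiv_lt_0_compat; auto|]. now apply Hcd. }
  intro k. destruct (Nat.le_gt_cases k D) as [Hk|Hk].
  - apply Rle_trans with (1 := H0 k). rewrite <- (Rmult_1_r A) at 1.
    apply (Hgen k O). unfold B; lia.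
  (* The quotient is the largest i with D + m i < k. *)
  - pose proof (Nat.div_mod_eq (k - D - 1) m) as Hd.
    pose proof (Nat.mod_upper_bound (k - D - 1) m ltac:(lia)) as Hd'.
    apply Rle_trans with (A * (1 / 2) ^ ((k - D - 1) / m)).
    + apply H1. lia.
    + apply Hgen. unfold B; lia.
Qed.

(** * The solutions at energies 0 and -2 *)

(** The product f_m = q_1 ... q_m, which is the inverse of the binomial coefficient (m + 32 choose
    32). *)
Fixpoint amplitude (m : nat) : R :=
  match m with
  | O => 1
  | S k => amplitude k * ((INR k + 1) / (INR k + 33))
  end.

Lemma amplitude_pos m : 0 < amplitude m.
Proof.
  induction m as [|m IH]; simpl; [lra|]. pose proof (pos_INR m).
  apply Rmult_lt_0_compat; auto. apply Rdiv_lt_0_compat; lra.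
Qed.

Lemma amplitude_le m : amplitude m <= / (INR m + 1).
Proof.
  induction m as [|m IH]; [simpl; lra|].
  change (amplitude (S m)) with (amplitude m * ((INR m + 1) / (INR m + 33))). rewrite S_INR.
  pose proof (pos_INR m) as Hm.
  apply Rle_trans with (/ (INR m + 1) * ((INR m + 1) / (INR m + 33))).
  - apply Rmult_le_compat_r; auto. apply Rlt_le, Rdiv_lt_0_compat; lra.
  - replace (/ (INR m + 1) * ((INR m + 1) / (INR m + 33))) with (/ (INR m + 33)) by (field; lra).
    apply Rinv_le_contravar; lra.
Qed.

Lemma div2_le_inv n : / (INR (Nat.div2 n) + 1) <= 2 / (INR n + 1).
Proof.
  pose proof (pos_INR n) as Hn. pose proof (pos_INR (Nat.div2 n)).
  assert (INR n <= 2 * INR (Nat.div2 n) + 1).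
  { replace (2 * INR (Nat.div2 n) + 1) with (INR (2 * Nat.div2 n + 1)).
    - apply le_INR. rewrite (Nat.div2_odd n) at 1. destruct (Nat.odd n); simpl; lia.
    - rewrite plus_INR, mult_INR. simpl. ring. }
  replace (2 / (INR n + 1)) with (/ ((INR n + 1) / 2)) by (field; lra).
  apply Rinv_le_contravar; lra.
Qed.

(** Comparison with a telescoping series. *)
Lemma ex_series_inv_square : ex_series (fun n => 4 / (INR n + 1) ^ 2).
Proof.
  assert (H : is_series (fun n => / (INR n + 1) - / (INR (S n) + 1)) 1).
  { apply is_series_Reals.
    assert (Hs : forall n, sum_f_R0 (fun n => / (INR n + 1) - / (INR (S n) + 1)) n = 1 - / (INR (S n) + 1)).
    { induction n as [|n IH]; [simpl; lra|]. rewrite tech5, IH. ring. }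
    intros eps He. destruct (INR_unbounded (/ eps)) as [N HN].
    exists N. intros n Hn. rewrite Hs. unfold R_dist, Rdist.
    assert (INR N <= INR n) by now apply le_INR.
    assert (0 < / eps) by now apply Rinv_0_lt_compat.
    rewrite S_INR. replace (1 - / (INR n + 1 + 1) - 1) with (- / (INR n + 1 + 1)) by ring.
    rewrite Rabs_Ropp, Rabs_pos_eq by (apply Rlt_le, Rinv_0_lt_compat; lra).
    rewrite <- (Rinv_inv eps). apply Rinv_lt_contravar; [|lra].
    apply Rmult_lt_0_compat; lra. }
  apply (ex_series_le (V := R_CompleteNormedModule) _ (fun n => 8 * (/ (INR n + 1) - / (INR (S n) + 1)))).
  - intro n. change (norm (4 / (INR n + 1) ^ 2)) with (Rabs (4 / (INR n + 1) ^ 2)).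
    pose proof (pos_INR n) as Hn.
    rewrite Rabs_pos_eq by (apply Rlt_le, Rdiv_lt_0_compat; [lra|apply pow_lt; lra]).
    rewrite S_INR.
    replace (8 * (/ (INR n + 1) - / (INR n + 1 + 1))) with (4 / (INR n + 1) ^ 2 * (2 * (INR n + 1) / (INR n + 2)))
      by (field; lra).
    rewrite <- (Rmult_1_r (4 / (INR n + 1) ^ 2)) at 1. apply Rmult_le_compat_l.
    + apply Rlt_le, Rdiv_lt_0_compat; [lra|apply pow_lt; lra].
    + apply Rmult_le_reg_r with (INR n + 2); [lra|].
      replace (2 * (INR n + 1) / (INR n + 2) * (INR n + 2)) with (2 * (INR n + 1)) by (field; lra). lra.
  - exists (scal 8 1). exact (is_series_scal_l 8 _ _ H).
Qed.

Lemma pot_eigenvalue_0 : is_eigenvalue pot 0.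
Proof.
  exists (fun n => (-1) ^ Nat.div2 n * amplitude (Nat.div2 n)). repeat split.
  - apply (ex_series_le (V := R_CompleteNormedModule) _ (fun n => 4 / (INR n + 1) ^ 2)); [|exact ex_series_inv_square].
    intro n. change (norm (((-1) ^ Nat.div2 n * amplitude (Nat.div2 n)) ^ 2)) with (Rabs (((-1) ^ Nat.div2 n * amplitude (Nat.div2 n)) ^ 2)).
    rewrite Rabs_pos_eq by apply pow2_ge_0.
    pose proof (amplitude_pos (Nat.div2 n)). pose proof (amplitude_le (Nat.div2 n)). pose proof (div2_le_inv n).
    pose proof (pos_INR n).
    replace (4 / (INR n + 1) ^ 2) with ((2 / (INR n + 1)) ^ 2) by (field; lra).
    replace (((-1) ^ Nat.div2 n * amplitude (Nat.div2 n)) ^ 2) with (amplitude (Nat.div2 n) ^ 2)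
      by (destruct (pow_m1_cases (Nat.div2 n)) as [e|e]; rewrite e; ring).
    apply pow_incr. lra.
  - exists O. simpl. lra.
  - intro n. rewrite Rmult_0_l. unfold hplus.
    destruct (Nat.Even_or_Odd n) as [[m ->]|[m ->]].
    + rewrite Nat.div2_succ_double, Nat.div2_double.
      destruct m as [|m]; [simpl; lra|].
      replace (2 * S m)%nat with (S (S (2 * m))) by lia.
      rewrite Nat.div2_succ_double, pot_even. simpl. pose proof (pos_INR m). field. lra.
    + rewrite Nat.add_1_r. replace (S (S (2 * m))) with (2 * S m)%nat by lia.
      rewrite Nat.div2_succ_double, !Nat.div2_double, pot_odd. simpl. pose proof (pos_INR m). field. lra.
Qed.

Definition ground (n : nat) : R := (-1) ^ n * amplitude (Nat.div2 n).

Lemma hplus_ground n : hplus pot ground n = -2 * ground n.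
Proof.
  unfold hplus, ground.
  destruct (Nat.Even_or_Odd n) as [[m ->]|[m ->]].
  - rewrite Nat.div2_succ_double, Nat.div2_double.
    destruct m as [|m]; [simpl; lra|].
    replace (2 * S m)%nat with (S (S (2 * m))) by lia.
    rewrite Nat.div2_succ_double, pot_even. pose proof (pos_INR m).
    change ((-1) ^ S (S (S (2 * m)))) with (-1 * (-1 * (-1 * (-1) ^ (2 * m)))).
    change ((-1) ^ S (S (2 * m))) with (-1 * (-1 * (-1) ^ (2 * m))).
    change ((-1) ^ S (2 * m)) with (-1 * (-1) ^ (2 * m)).
    simpl amplitude. field. lra.
  - rewrite Nat.add_1_r. replace (Nat.div2 (S (S (2 * m)))) with (S m) by (symmetry; rewrite <- (Nat.div2_double (S m)); f_equal; lia).
    rewrite Nat.div2_succ_double, !Nat.div2_double, pot_odd. pose proof (pos_INR m).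
    change ((-1) ^ S (S (2 * m))) with (-1 * (-1 * (-1) ^ (2 * m))).
    change ((-1) ^ S (2 * m)) with (-1 * (-1) ^ (2 * m)).
    simpl amplitude. field. lra.
Qed.

Lemma ground_alternates n : ground n * ground (S n) < 0.
Proof.
  unfold ground. pose proof (amplitude_pos (Nat.div2 n)). pose proof (amplitude_pos (Nat.div2 (S n))).
  replace ((-1) ^ n * amplitude (Nat.div2 n) * ((-1) ^ S n * amplitude (Nat.div2 (S n))))
    with (- (amplitude (Nat.div2 n) * amplitude (Nat.div2 (S n))))
    by (simpl pow; destruct (pow_m1_cases n) as [e|e]; rewrite e; ring).
  nra.
Qed.

Lemma ground_bound n : Rabs (ground n) <= 1.
Proof.
  unfold ground. pose proof (amplitude_pos (Nat.div2 n)).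
  pose proof (amplitude_le (Nat.div2 n)). pose proof (pos_INR (Nat.div2 n)).
  assert (/ (INR (Nat.div2 n) + 1) <= 1) by (rewrite <- Rinv_1; apply Rinv_le_contravar; lra).
  rewrite Rabs_mult, pow_1_abs, Rabs_pos_eq; lra.
Qed.

(** Inductively u and g agree in sign, so the Wronskian changes by (E - x) u g < 0 at each site and
    stays below E - x. Decay of u and boundedness of g would send it to 0. *)
Lemma no_eigenvalue_below V x g E :
  (forall n, hplus V g n = x * g n) -> (forall n, g n * g (S n) < 0) ->
  (forall n, Rabs (g n) <= 1) -> g O = 1 -> E < x -> ~ is_eigenvalue V E.
Proof.
  intros Hg Halt Hb H0 HE He. apply eigenvalue_sol_l2, l2_lim_0 in He.
  set (u := sol V E) in *.
  assert (Hu : forall n, hplus V u n = E * u n) by apply hplus_sol.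
  assert (H : forall n, 0 < u n * g n /\ u (S n) * g n - u n * g (S n) <= E - x).
  { induction n as [|n [IH1 IH2]].
    - pose proof (Hg O) as g0. pose proof (Hu O) as u0. unfold hplus in g0, u0.
      assert (u O = 1) by apply sol_0. rewrite H, H0 in *. split; nra.
    - pose proof (Hg (S n)) as gS. pose proof (Hu (S n)) as uS. unfold hplus in gS, uS.
      (* The negative Wronskian gives u (n+1) g n < u n g (n+1) < 0, and the sign change of g turns
         this into agreement at n + 1. *)
      assert (Hpos : 0 < u (S n) * g (S n)).
      { assert (Hneg : u (S n) * g n < 0).
        { assert (u n * g (S n) < 0); [|lra]. specialize (Halt n).
          assert (0 < g n * g n) by nra.
          assert ((u n * g (S n)) * (g n * g n) < 0).
          { replace ((u n * g (S n)) * (g n * g n)) with ((u n * g n) * (g n * g (S n))) by ring. nra. }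
          nra. }
        specialize (Halt n).
        assert (0 < g n * g n) by nra.
        assert (0 < (u (S n) * g (S n)) * (g n * g n)).
        { replace ((u (S n) * g (S n)) * (g n * g n)) with ((u (S n) * g n) * (g n * g (S n))) by ring. nra. }
        nra. }
      split; auto.
      replace (u (S (S n))) with ((E - V (S n)) * u (S n) - u n) by lra.
      replace (g (S (S n))) with ((x - V (S n)) * g (S n) - g n) by lra.
      nra. }
  apply is_lim_seq_spec in He.
  assert (Hd : 0 < (x - E) / 2) by lra.
  destruct (He (mkposreal _ Hd)) as [N HN].
  pose proof (HN N ltac:(lia)) as K1. pose proof (HN (S N) ltac:(lia)) as K2. simpl in K1, K2.
  rewrite Rminus_0_r in K1, K2.
  destruct (H N) as [_ HW].
  assert (Rabs (u (S N) * g N - u N * g (S N)) < x - E).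
  { apply Rle_lt_trans with (Rabs (u (S N)) + Rabs (u N)); [|lra].
    unfold Rminus. apply Rle_trans with (1 := Rabs_triang _ _). rewrite Rabs_Ropp, !Rabs_mult.
    pose proof (Hb N). pose proof (Hb (S N)). pose proof (Rabs_pos (u N)). pose proof (Rabs_pos (u (S N))). nra. }
  apply Rabs_def2 in H1. lra.
Qed.

Lemma pot_bound_state_gt_2 x : bound_state pot x -> 2 < x.
Proof.
  intros [He [H|H]]; auto. exfalso.
  apply (no_eigenvalue_below pot (-2) ground x); auto using hplus_ground, ground_alternates, ground_bound.
  unfold ground; simpl; ring.
Qed.

(** * Enumeration of the bound states by node count *)

Lemma injective_avoids_list (E : nat -> R) :
  (forall k1 k2, E k1 = E k2 -> k1 = k2) ->
  forall l, exists K, forall k, (K <= k)%nat -> ~ List.In (E k) l.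
Proof.
  intros Hinj l. induction l as [|y l [K IH]]; [exists O; intros k _ []|].
  destruct (classic (exists j, E j = y)) as [[j Hj]|Hno].
  - exists (max K (S j)). intros k Hk [e|Hin].
    + rewrite <- Hj in e. apply Hinj in e. lia.
    + apply (IH k); auto; lia.
  - exists K. intros k Hk [e|Hin]; [apply Hno; now exists k|apply (IH k); auto].
Qed.

Theorem theorem2p1 :
  exists V : nat -> R,
    is_eigenvalue V 0 /\
    (* infinitely many bound states *)
    (forall l : list R, exists E : R, bound_state V E /\ ~ List.In E l) /\
    exists E : nat -> R,
      (forall k, bound_state V (E k)) /\
      (forall x, bound_state V x -> exists k, E k = x) /\
      (forall k1 k2, E k1 = E k2 -> k1 = k2) /\
      (forall k, Rabs (E (S k)) <= Rabs (E k)) /\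
      exists b c C1 C2 : R,
        0 < b /\ b <= c /\ c < 1 /\ 0 < C1 /\ 0 < C2 /\
        forall k : nat,
          C1 * b ^ (S k) <= Rabs (E k) - 2 /\ Rabs (E k) - 2 <= C2 * c ^ (S k).
Proof.
  set (E := fun j => proj1_sig (constructive_indefinite_description _ (pot_eigenvalue j))).
  assert (HE : forall j, 2 + (1 / 4) ^ (10 + j) <= E j /\ is_eigenvalue pot (E j) /\ eventual_nodes pot (E j) j)
    by (intro j; exact (proj2_sig (constructive_indefinite_description _ (pot_eigenvalue j)))).
  clearbody E.
  assert (H2 : forall j, 2 < E j).
  { intro j. destruct (HE j) as [H _]. assert (0 < (1 / 4) ^ (10 + j)) by (apply pow_lt; lra). lra. }
  assert (Habs : forall j, Rabs (E j) = E j) by (intro j; specialize (H2 j); apply Rabs_pos_eq; lra).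
  assert (Hinj : forall k1 k2, E k1 = E k2 -> k1 = k2).
  { intros k1 k2 e. destruct (HE k1) as (_ & _ & h1), (HE k2) as (_ & _ & h2).
    pose proof (eventual_nodes_mono _ _ _ _ _ h1 h2 ltac:(lra)).
    pose proof (eventual_nodes_mono _ _ _ _ _ h2 h1 ltac:(lra)). lia. }
  assert (Hbs : forall k, bound_state pot (E k)).
  { intro k. split; [apply HE|right; apply H2]. }
  exists pot. split; [exact pot_eigenvalue_0|]. split.
  { intro l. destruct (injective_avoids_list E Hinj l) as [K HK].
    exists (E K). split; auto. }
  exists E. split; [exact Hbs|]. split; [|split; [exact Hinj|split]].
  - intros x Hx. pose proof (pot_bound_state_gt_2 x Hx) as Hx2. destruct Hx as [Hx _].
    destruct (eigenvalue_eventual_nodes pot x pot_limsup Hx2 Hx) as [c Hc].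
    exists c. destruct (HE c) as (_ & h1 & h2).
    destruct (Rtotal_order (E c) x) as [h|[h|h]]; auto; exfalso.
    + exact (eigenvalue_nodes_lt pot (E c) x c pot_limsup (H2 c) h h1 Hx h2 Hc).
    + exact (eigenvalue_nodes_lt pot x (E c) c pot_limsup Hx2 h Hx h1 Hc h2).
  - intro k. rewrite !Habs. destruct (Rle_or_lt (E (S k)) (E k)) as [|h]; auto. exfalso.
    destruct (HE k) as (_ & _ & h1), (HE (S k)) as (_ & _ & h2).
    pose proof (eventual_nodes_mono _ _ _ _ _ h1 h2 ltac:(lra)). lia.
  (* Here 64 bounds every excess, since pot <= 64, and each 256 further nodes halve the bound. *)
  - destruct (geometric_of_halving (fun k => E k - 2) 64 256 (S (2 * 2 ^ 10))) as (C & c & HC & Hc & H).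
    + lia.
    + lra.
    + intro k. pose proof (eigenvalue_le_bound pot (E k) 64 pot_le_64 (proj1 (Hbs k))). lra.
    + intros k i Hk. destruct (HE k) as (_ & h1 & h2).
      apply (pot_eigenvalue_upper (E k) k i h1 h2). lia.
    (* The exponent 10 + k splits as 9 + S k, whence C1 = (1 / 4) ^ 9; b <= c holds because c >= 1 /
       2. *)
    + exists (1 / 4), c, ((1 / 4) ^ 9), C.
      repeat split; try lra; try (apply pow_lt; lra); rewrite Habs; [|apply H].
      rewrite <- pow_add. replace (9 + S k)%nat with (10 + k)%nat by lia.
      destruct (HE k) as [h _]. lra.
Qed.
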